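(* Let $\Phi$ be a real-valued continuously differentiable function with locally Lipschitz gradient on an open neighborhood of $\mathbb R_+^n=\{x\in\mathbb R^n:x\ge 0\}$. For each $i\in\{1,\dots,n\}$ let $g_i:\mathbb R\to(0,+\infty)$ be a $C^1$ increasing diffeomorphism with $g_i'(s)>0$ for every $s\in\mathbb R$, $\lim_{s\to-\infty}g_i(s)=0$ and $\lim_{s\to-\infty}g_i'(s)=0$, and write $g(u)=(g_1(u_1),\dots,g_n(u_n))$. Let $u:[0,+\infty)\to\mathbb R^n$ solve $$\dot u(t)=-\nabla\Phi(x(t)),\qquad x(t)=g(u(t)),\qquad t\ge 0,$$ and assume that $x(t)\to x^\star\in\mathbb R_+^n$ as $t\to+\infty$. Then $$x^\star\ge 0,\qquad \nabla\Phi(x^\star)\ge 0,\qquad x_i^\star\,\nabla_i\Phi(x^\star)=0\quad\text{for all }i.$$ Hence $x^\star$ satisfies the KKT conditions of the problem $\min_{x\ge 0}\Phi(x)$.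
   Context: Vector inequalities are componentwise, and $\nabla_i\Phi$ denotes the $i$-th component of the Euclidean gradient. The KKT conditions of $\min_{x\ge0}\Phi(x)$ at $x^\star$ are $x^\star\ge0$, $\nabla\Phi(x^\star)\ge0$ and $x_i^\star\nabla_i\Phi(x^\star)=0$ for all $i$. *)

(* Defs.v *)
From HB Require Import structures.
From mathcomp Require Export all_boot all_order all_algebra.
From mathcomp Require Export all_classical all_reals all_analysis.
Export Order.TTheory GRing.Theory Num.Theory.
Export numFieldNormedType.Exports.

Set Implicit Arguments.
Unset Strict Implicit.
Unset Printing Implicit Defensive.

Local Open Scope ring_scope.
Local Open Scope classical_set_scope.

Definition nonneg_orthant (R : realType) (n : nat) : set 'rV[R]_n :=
  [set x | forall i, 0 <= x 0 i].
Arguments nonneg_orthant : clear implicits.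

Definition gradient (R : realType) (n : nat) (Phi : 'rV[R]_n -> R)
    (x : 'rV[R]_n) : 'rV[R]_n :=
  \row_i 'D_(delta_mx 0 i) Phi x.

(* The next three predicates are meant for an open set U (resp. A), in which
   case the values of the function outside of that set are irrelevant. *)
Definition continuously_differentiable_on (R : realType) (n : nat)
    (U : set 'rV[R]_n) (Phi : 'rV[R]_n -> R) : Prop :=
  forall x, U x -> differentiable Phi x /\ {for x, continuous (gradient Phi)}.

Definition locally_lipschitz_on (R : realType) (V W : normedModType R)
    (U : set V) (f : V -> W) : Prop :=
  forall x, U x -> exists2 N, nbhs x N & [lipschitz f y | y in N].

Definition C1_on (R : realType) (A : set R) (f : R -> R) : Prop :=
  forall s, A s -> derivable f s 1 /\ {for s, continuous f^`()}.

Definition C1_diffeomorphism (R : realType) (A B : set R) (f : R -> R) : Prop :=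
  [/\ set_bij A B f, C1_on A f &
    exists h : R -> R, C1_on B h /\ forall s, A s -> h (f s) = s].

(* Derivative relative to D: one-sided at an endpoint of an interval D, and
   insensitive to the values of u outside of D. *)
Definition has_derivative_within (R : realType) (V : normedModType R)
    (D : set R) (u : R -> V) (t : R) (l : V) : Prop :=
  (s - t)^-1 *: (u s - u t) @[s --> within D t^'] --> l.

Definition coordinatewise (R : realType) (n : nat) (g : 'I_n -> R -> R)
    (u : 'rV[R]_n) : 'rV[R]_n :=
  \row_i g i (u 0 i).

(* The KKT conditions of the minimization of Phi over the nonnegative orthant. *)
Definition KKT_nonneg (R : realType) (n : nat) (Phi : 'rV[R]_n -> R)
    (x : 'rV[R]_n) : Prop :=
  [/\ forall i, 0 <= x 0 i,
      forall i, 0 <= gradient Phi x 0 i &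
      forall i, x 0 i * gradient Phi x 0 i = 0].

(* Main.v *)
Require Import Defs.
From mathcomp Require Import lra.

Local Open Scope ring_scope.
Local Open Scope classical_set_scope.

(** Fix a coordinate [i] and let [c] be the [i]-th component of the gradient of
    [Phi] at [xstar]. The gradient is continuous at [xstar], so the velocity
    [- gradient Phi (x t) 0 i] of the dual coordinate [u t 0 i] tends to [- c].
    A real function whose derivative has a nonzero limit diverges to the
    infinity of the same sign ([derive_cvg_pos_cvgy], [derive_cvg_neg_cvgNy],
    by the mean value theorem). Since [x t 0 i = g i (u t 0 i)]:
    - if [c < 0], then [u t 0 i] tends to [+oo]; as [g i] is increasing and maps
      onto all positive reals, [x t 0 i] eventually exceeds any bound, which
      contradicts its convergence;
    - if [c > 0], then [u t 0 i] tends to [-oo], where [g i] vanishes, so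
      [xstar 0 i = 0].
    Hence [c] is nonnegative and is zero unless [xstar 0 i] is, which is the
    stationarity and complementarity part of the KKT conditions. *)

(** Interior points of [D] are limits from both sides inside [D], so there the
    relative derivative is the ordinary one; this gives access to the mean
    value theorem. *)
Lemma has_derivative_within_is_derive (R : realType) (V : normedModType R)
    (D : set R) (u : R -> V) (t : R) (l : V) :
  interior D t -> has_derivative_within D u t l -> is_derive t 1 u l.
Proof.
move=> Dt ul.
have shiftD : h + t @[h --> 0^'] --> within D t^'.
  have h0 : h + t @[h --> (0 : R)] --> t.
    rewrite -[X in _ --> X]add0r.
    by apply: cvgD; [exact: cvg_id | exact: cvg_cst].
  move=> A; rewrite /within /= => tA.
  have {}tA : \forall s \near t, s != t -> A s.
    by apply: filterS2 Dt tA => s Ds sA st; exact: sA.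
  have {}tA : \forall h \near (0 : R), h + t != t -> A (h + t) := h0 _ tA.
  have : \forall h \near (0 : R), h != 0 -> A (h + t) => //.
  by apply: filterS tA => h hA hn0; apply: hA; rewrite -subr_eq0 addrK.
have quot : h^-1 *: ((u \o shift t) (h *: 1) - u t) @[h --> 0^'] --> l.
  have := cvg_comp _ _ shiftD ul; apply: cvg_trans; apply: near_eq_cvg.
  by near=> h; rewrite /= addrK /GRing.scale /= mulr1.
by split; [apply/cvg_ex; exists l | exact/cvg_lim].
Unshelve. all: by end_near. Qed.

Lemma has_derivative_within_coord (R : realType) (n : nat) (D : set R)
    (u : R -> 'rV[R]_n) (t : R) (l : 'rV[R]_n) (i : 'I_n) :
  has_derivative_within D u t l ->
  has_derivative_within D (fun s => u s 0 i) t (l 0 i).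
Proof.
move=> ul; have := cvg_comp _ _ ul (@coord_continuous R 1 n 0 i l).
apply: cvg_trans; apply: near_eq_cvg; apply: nearW => s /=.
by rewrite !mxE.
Qed.

(** Beyond some [T] the derivative exceeds [l / 2], so by the mean value theorem
    [f] lies above a line of slope [l / 2]. *)
Lemma derive_cvg_pos_cvgy (R : realType) (f df : R -> R) (l : R) :
  0 < l -> (forall t : R, 0 < t -> is_derive t 1 f (df t)) ->
  df t @[t --> +oo] --> l -> f t @[t --> +oo] --> +oo.
Proof.
move=> l0 fdf dfl; apply/cvgryPge => A.
have l2 : l / 2 < l by lra.
have [T [Treal dfT]] := cvgr_gt l dfl _ l2.
pose a := Num.max T 1; have a0 : 0 < a by rewrite /a lt_max ltr01 orbT.
have aT : T <= a by rewrite /a le_max lexx.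
near=> t.
have at_ : a < t by near: t; apply: nbhs_pinfty_gt; exact: num_real.
have tA : a + 2 / l * (A - f a) < t.
  by near: t; apply: nbhs_pinfty_gt; exact: num_real.
have fcont : {within `[a, t], continuous f}.
  apply: derivable_within_continuous => s; rewrite in_itv /= => /andP[as_ _].
  have := fdf s (lt_le_trans a0 as_).
  by case.
have fder s : s \in `]a, t[%R -> is_derive s 1 f (df s).
  by rewrite in_itv /= => /andP[as_ _]; exact/fdf/(lt_trans a0).
have [s] := MVT at_ fder fcont.
rewrite in_itv /= => /andP[as_ _] ft.
have dfs : l / 2 < df s by apply: dfT; exact: le_lt_trans as_.
have : l / 2 * (t - a) <= df s * (t - a).
  by rewrite ler_wpM2r ?ltW // subr_gt0.
have : l / 2 * (2 / l * (A - f a)) <= l / 2 * (t - a).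
  by rewrite ler_wpM2l ?ltW ?divr_gt0 //; lra.
have -> : l / 2 * (2 / l * (A - f a)) = A - f a.
  by rewrite mulrA mulf_div [2 * l]mulrC divff ?mul1r // mulf_neq0 ?gt_eqF.
lra.
Unshelve. all: by end_near. Qed.

Lemma derive_cvg_neg_cvgNy (R : realType) (f df : R -> R) (l : R) :
  l < 0 -> (forall t : R, 0 < t -> is_derive t 1 f (df t)) ->
  df t @[t --> +oo] --> l -> f t @[t --> +oo] --> -oo.
Proof.
move=> l0 fdf dfl; apply/cvgNry.
apply: (@derive_cvg_pos_cvgy _ _ (- df) (- l)); first by rewrite oppr_gt0.
- by move=> t /fdf ft; exact: is_deriveN.
- exact: cvgN.
Qed.

(** A finite limit of [g (v t)] would bound it by some positive [M = g s], whereas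
    eventually [s < v t]. *)
Lemma surj_increasing_comp_not_cvg (R : realType) (g v : R -> R) (l : R) :
  set_surj setT `]0, +oo[ g -> {homo g : s t / s < t} ->
  v t @[t --> +oo] --> +oo -> ~ (g (v t) @[t --> +oo] --> l).
Proof.
move=> gsurj gincr vy gvl.
pose M := Num.max l 0 + 1.
have M0 : 0 < M by rewrite ltr_pwDr // le_max lexx orbT.
have lM : l < M by rewrite /M ltr_pwDr // le_max lexx.
have [|s _ gs] := gsurj M; first by rewrite /= in_itv /= M0.
have [t [tM st]] : exists t, g (v t) < M /\ s < v t.
  apply: (@filter_ex _ (pinfty_nbhs R)).
  by apply: filterI; [exact: (cvgr_lt l gvl) | exact: (cvgry_gt vy)].
by have := lt_trans (gincr _ _ st) tM; rewrite gs ltxx.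
Qed.

Theorem proposition5p1 (R : realType) (n : nat)
    (Phi : 'rV[R]_n -> R) (U : set 'rV[R]_n)
    (hUopen : open U) (hUorthant : nonneg_orthant R n `<=` U)
    (hPhi : continuously_differentiable_on U Phi)
    (hPhiLip : locally_lipschitz_on U (gradient Phi))
    (g : 'I_n -> R -> R)
    (hg : forall i, C1_diffeomorphism setT `]0, +oo[ (g i))
    (hgincr : forall i, {homo g i : s t / s < t})
    (hgder : forall i s, 0 < (g i)^`() s)
    (hglim : forall i, g i s @[s --> -oo] --> (0 : R))
    (hgderlim : forall i, (g i)^`() s @[s --> -oo] --> (0 : R))
    (u x : R -> 'rV[R]_n) (xstar : 'rV[R]_n)
    (hx : forall t, 0 <= t -> x t = coordinatewise g (u t))
    (hu : forall t, 0 <= t ->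
       has_derivative_within `[0, +oo[ u t (- gradient Phi (x t)))
    (hxstar : nonneg_orthant R n xstar)
    (hlim : x t @[t --> +oo] --> xstar) :
  KKT_nonneg Phi xstar.
Proof.
have [_ gradC] := hPhi _ (hUorthant _ hxstar).
have velocity i : (- gradient Phi (x t)) 0 i @[t --> +oo] -->
    - gradient Phi xstar 0 i.
  have := cvg_comp _ _ (cvg_comp _ _ hlim gradC)
    (@coord_continuous R 1 n 0 i (gradient Phi xstar)).
  move=> /cvgN; apply: cvg_trans; apply: near_eq_cvg; apply: nearW => t.
  by rewrite [RHS]mxE.
have du i (t : R) : 0 < t ->
    is_derive t 1 (fun s => u s 0 i) ((- gradient Phi (x t)) 0 i).
  move=> t0; apply: (@has_derivative_within_is_derive _ _ `[0, +oo[).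
    apply: filterS (lt_nbhsr t0) => s /= s0.
    by rewrite in_itv /= ltW.
  exact/has_derivative_within_coord/hu/ltW.
have gux i : g i (u t 0 i) @[t --> +oo] --> xstar 0 i.
  have := cvg_comp _ _ hlim (@coord_continuous R 1 n 0 i xstar).
  apply: cvg_trans; apply: near_eq_cvg.
  near=> t; have t0 : 0 <= t.
    by near: t; apply: nbhs_pinfty_ge; exact: num_real.
  by rewrite /= hx // mxE.
have grad_ge0 i : 0 <= gradient Phi xstar 0 i.
  rewrite leNgt; apply/negP => c0.
  have uy : u t 0 i @[t --> +oo] --> +oo.
    by apply: derive_cvg_pos_cvgy (du i) (velocity i); rewrite oppr_gt0.
  have [[_ _ gsurj] _ _] := hg i.
  exact: surj_increasing_comp_not_cvg gsurj (hgincr i) uy (gux i).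
split=> // i.
have := grad_ge0 i; rewrite le_eqVlt => /predU1P[<-|c0]; first by rewrite mulr0.
have uNy : u t 0 i @[t --> +oo] --> -oo.
  by apply: derive_cvg_neg_cvgNy (du i) (velocity i); rewrite oppr_lt0.
have gu0 := cvg_comp _ _ uNy (hglim i).
by rewrite (norm_cvg_unique (gux i) gu0) mul0r.
Unshelve. all: by end_near. Qed.
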